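(* Every nontrivially unstable circulant graph $\operatorname{Cay}(\mathbb{Z}_n,S)$ of valency at most $4$ has Wilson type (C.4), i.e., $n$ is even and there exists $m\in\mathbb{Z}_n^\times$ with $(n/2)+mS=S$.
   Context: All graphs are finite, undirected and simple. For $S\subseteq\mathbb{Z}_n\setminus\{0\}$ with $S=-S$, $\operatorname{Cay}(\mathbb{Z}_n,S)$ has vertex set $\mathbb{Z}_n$, with $v\sim w$ iff $w-v\in S$. The canonical bipartite double cover $BX$ of $X$ has vertex set $V(X)\times\{0,1\}$, with $(v,0)\sim(w,1)$ iff $v\sim w$ in $X$. $X$ is unstable if $\operatorname{Aut}BX\neq\operatorname{Aut}X\times S_2$. A graph is twin-free if no two distinct vertices have the same neighbourhood. $X$ is nontrivially unstable if it is connected, nonbipartite, twin-free and unstable. *)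

(* Defs.v *)
From HB Require Import structures.
From mathcomp Require Import all_boot all_order all_algebra all_fingroup.

Set Implicit Arguments.
Unset Strict Implicit.
Unset Printing Implicit Defensive.

Import GRing.Theory.
Local Open Scope ring_scope.

(* A finite simple graph is an irreflexive symmetric relation [e : rel T] on
   a finite type.  For [cayley S] these two properties amount to
   [0 \notin S] and [-S = S]. *)

Definition cayley n (S : {set 'Z_n}) : rel 'Z_n := fun v w => w - v \in S.

Section Graph.
Variables (T : finType) (e : rel T).

Definition nbhd (v : T) : {set T} := [set w | e v w].

Definition has_valency (d : nat) : Prop := forall v, #|nbhd v| = d.

Definition connected_graph : Prop := forall v w, connect e v w.

Definition bipartite : Prop :=
  exists c : T -> bool, forall v w, e v w -> c v != c w.

Definition twin_free : Prop := forall v w, nbhd v = nbhd w -> v = w.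

Definition graph_aut : {set {perm T}} :=
  [set f : {perm T} | [forall v, forall w, e (f v) (f w) == e v w]].

(* The layers 0 and 1 are [false] and [true]. *)
Definition double_cover : rel (T * bool) :=
  fun x y => (x.2 != y.2) && e x.1 y.1.

End Graph.

Section ProdPerm.
Variables (A B : finType) (f : {perm A}) (g : {perm B}).

Lemma prod_perm_inj : injective (fun x : A * B => (f x.1, g x.2)).
Proof. by move=> [a b] [c d] /= [] /perm_inj -> /perm_inj ->. Qed.

Definition prod_perm : {perm A * B} := perm prod_perm_inj.

End ProdPerm.

(* [Aut X x S_2], as the subgroup of [Aut BX] in which [S_2] permutes the two
   layers. *)
Definition expected_aut (T : finType) (e : rel T) : {set {perm T * bool}} :=
  [set prod_perm f s | f in graph_aut e, s in [set: {perm bool}]].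

Definition unstable (T : finType) (e : rel T) : Prop :=
  graph_aut (double_cover e) <> expected_aut e.

Definition nontrivially_unstable (T : finType) (e : rel T) : Prop :=
  [/\ connected_graph e, ~ bipartite e, twin_free e & unstable e].

Definition wilson_C4 n (S : {set 'Z_n}) : Prop :=
  ~~ odd n /\
  exists2 m : 'Z_n, m \is a GRing.unit &
    [set (n./2)%:R + m * s | s in S] = S.

(* ['Z_n] is the ring of integers mod [n] only for [1 < n].  Nothing is lost by
   excluding [n = 1]: a one-vertex graph is bipartite. *)
Lemma one_vertex_not_nontrivially_unstable (T : finType) (e : rel T) :
  irreflexive e -> #|T| = 1%N -> ~ nontrivially_unstable e.
Proof.
move=> e_irr /fintype1 [x Tx] [_ nbip _ _]; apply: nbip.
by exists (fun=> false) => v w; rewrite (Tx v) (Tx w) e_irr.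
Qed.

(* Main.v *)
Require Import Defs.
From mathcomp Require Import all_boot all_order all_algebra all_fingroup.
From mathcomp Require Import ring.

Set Implicit Arguments.
Unset Strict Implicit.
Unset Printing Implicit Defensive.

Import GRing.Theory.
Local Open Scope ring_scope.

(* The proof separates the parities of n.

   If n is odd, x and y have an odd number of common neighbours iff y - x lies in
   2S, because w |-> x + y - w pairs off the common neighbours other than the
   midpoint.  A layer-preserving automorphism of BX therefore acts on each layer
   as an automorphism of Cay(Z_n, 2S), hence of Cay(Z_n, 4S), and so on; as
   doubling permutes the subsets of Z_n, this comes back to S.  Twin-freeness then
   forces the two layer actions to agree, so X is stable.

   If n is even, S contains an odd and an even element, since X is connected and
   nonbipartite.  Hence p and 3p cannot account for all of S up to sign, and 2p = 2q
   would create twins.  Without these coincidences, and unless X = K_4, a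
   layer-preserving automorphism of BX maps opposite edges at a vertex to opposite
   edges and the 4-cycles 0, p, p + q, q to translates of such cycles.  Normalised
   to fix (0,0), it is then a group automorphism of Z_n x Z_2; it sends (0,1) to
   (t,1) with 2t = 0, so t = n/2 if t <> 0, and its restriction to Z_n is the
   multiplication by the unit m of (C.4). *)

Section FiniteTypes.
Variable T : finType.

Lemma connect_ind (e : rel T) (P : T -> Prop) x y :
  (forall u v, e u v -> P u -> P v) -> connect e x y -> P x -> P y.
Proof.
move=> Pe /connectP [p]; elim: p x => [|z p IHp] x /= => [_ -> //|].
by case/andP=> exz ep Ey Px; apply: (IHp z) => //; apply: Pe Px.
Qed.

Lemma odd_card_involution (f : T -> T) (A : {set T}) :
  involutive f -> {in A, forall x, f x \in A} ->
  odd #|A| = odd #|[set x in A | f x == x]|.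
Proof.
move=> fK; have [k] := ubnP #|A|; elim: k A => // k IHk A A_lt fA.
have [x /andP [xA fx] | fix_f] := pickP [pred x in A | f x != x]; last first.
  congr (odd #|pred_of_set _|); apply/setP=> x; rewrite inE.
  by have := fix_f x; rewrite /=; case: (x \in A) => //= /negbFE ->.
have card_A : #|A| = #|A :\ x :\ f x|.+2.
  by rewrite (cardsD1 x) xA (cardsD1 (f x) (A :\ x)) !inE fx fA.
have -> : [set y in A | f y == y] = [set y in A :\ x :\ f x | f y == y].
  apply/setP=> y; rewrite !inE; have [-> | _] := eqVneq y x.
    by rewrite (negbTE fx) !andbF.
  by have [-> | _] := eqVneq y (f x); rewrite ?fK 1?eq_sym ?(negbTE fx) ?andbF.
rewrite card_A /= negbK; apply: IHk => [|y].
  by rewrite card_A ltnS in A_lt; apply: ltnW.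
rewrite !inE (inj_eq (inv_inj fK)) => /and3P [yfx yx yA].
by rewrite yx fA // -(inj_eq (inv_inj fK)) fK yfx.
Qed.

Lemma graph_autP (e : rel T) (f : {perm T}) :
  reflect (forall v w, e (f v) (f w) = e v w) (f \in graph_aut e).
Proof.
rewrite inE; apply: (iffP forallP) => [f_aut v w | f_aut v].
  by move/forallP: (f_aut v) => /(_ w) /eqP.
by apply/forallP=> w; rewrite f_aut.
Qed.

End FiniteTypes.

Section DoubleCover.
Variables (T : finType) (e : rel T).

Lemma not_bipartite_edge (c : T -> bool) :
  ~ bipartite e -> exists u v, e u v /\ c u = c v.
Proof.
move=> nbip; have [/existsP [u /existsP [v /andP [uv /eqP cuv]]] | no_uv] :=
  boolP [exists u, exists v, e u v && (c u == c v)]; first by exists u, v.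
case: nbip; exists c => u v uv; apply: contraNneq no_uv => cuv.
by apply/existsP; exists u; apply/existsP; exists v; rewrite uv cuv eqxx.
Qed.

Lemma double_cover_connected :
  symmetric e -> connected_graph e -> ~ bipartite e ->
  connected_graph (double_cover e).
Proof.
move=> e_sym e_conn nbip; set R := connect (double_cover e).
have R_sym : connect_sym (double_cover e).
  by apply: sym_connect_sym => x y; rewrite /double_cover e_sym eq_sym.
have R_edge x u v i : e u v -> R x (u, i) -> R x (v, ~~ i).
  move=> uv /connect_trans; apply; apply: connect1.
  by rewrite /double_cover /= uv; case: i.
have R_some_layer v w : R (v, false) (w, false) || R (v, false) (w, true).
  pose P w := R (v, false) (w, false) || R (v, false) (w, true).
  apply: (connect_ind (P := P)) (e_conn v w) _ => [u u' uu' |].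
    by case/orP=> /(R_edge _ _ _ _ uu') /= Ru'; rewrite /P Ru' ?orbT.
  by rewrite /P /R connect0.
have R_false v x : R (v, false) x.
  have [u [w [uw c_uw]]] := not_bipartite_edge (fun w => R (v, false) (w, false)) nbip.
  have R_w : R (v, false) (w, false) /\ R (v, false) (w, true).
    case Ru: (R (v, false) (u, false)) c_uw => c_uw.
      by rewrite -c_uw; split=> //; apply: R_edge uw Ru.
    have := R_some_layer v u; rewrite Ru => /(R_edge _ _ _ _ uw).
    by rewrite -c_uw.
  have [] : R (v, false) (x.1, false) /\ R (v, false) (x.1, true).
    pose P w := R (v, false) (w, false) /\ R (v, false) (w, true).
    apply: (connect_ind (P := P)) (e_conn w x.1) R_w => y z yz [R_yf R_yt].
    by split; [apply: R_edge yz R_yt | apply: R_edge yz R_yf].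
  by case: x => [y []].
by move=> [v i] x; apply: connect_trans (R_false v x); rewrite R_sym; apply: R_false.
Qed.

Lemma expected_aut_sub : expected_aut e \subset graph_aut (double_cover e).
Proof.
apply/subsetP=> _ /imset2P [f s /graph_autP f_aut _ ->]; rewrite inE.
apply/forallP=> x; apply/forallP=> y.
by rewrite /double_cover !permE /= (inj_eq perm_inj) f_aut.
Qed.

(* [F false] and [F true] are the actions, on the two layers of the double
   cover, of an automorphism that preserves each layer. *)
Definition twofold_aut (F : bool -> T -> T) : Prop :=
  (forall i, injective (F i)) /\
  (forall i v w, e (F i v) (F (~~ i) w) = e v w).

Definition layer_action (f : {perm T * bool}) (i : bool) (v : T) : T :=
  (f (v, i)).1.

Section LayerAction.
Variable f : {perm T * bool}.
Hypothesis dc_conn : connected_graph (double_cover e).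
Hypothesis f_aut : f \in graph_aut (double_cover e).

Lemma layer_shift_const x y : (f x).2 (+) x.2 = (f y).2 (+) y.2.
Proof.
have /graph_autP f_edge := f_aut.
pose P y := (f x).2 (+) x.2 = (f y).2 (+) y.2.
apply: (connect_ind (P := P)) (dc_conn x y) _ => // u v uv; rewrite /P => ->.
have := f_edge u v; rewrite uv => /andP [fuv _]; case/andP: uv => uv _.
by move: fuv uv; case: (f u).2 (f v).2 (u.2) (v.2) => [] [] [] [].
Qed.

Lemma layer_action_twofold_aut : twofold_aut (layer_action f).
Proof.
have /graph_autP f_edge := f_aut.
split=> [i v w eq_vw | i v w].
  suff [] : (v, i) = (w, i) by [].
  apply: (@perm_inj _ f); rewrite [LHS]surjective_pairing [RHS]surjective_pairing.
  by congr pair; last exact: addIb (layer_shift_const (v, i) (w, i)).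
have := f_edge (v, i) (w, ~~ i); have := layer_shift_const (v, i) (w, ~~ i).
rewrite /double_cover /layer_action /=.
move: (f (v, i)).2 (f (w, ~~ i)).2 => j k.
by case: i; case: j; case: k.
Qed.

Lemma expected_aut_layer_action :
  layer_action f false =1 layer_action f true -> f \in expected_aut e.
Proof.
move=> F_const; set F := layer_action f false.
have F_aut := layer_action_twofold_aut.
have {}F_const i : layer_action f i =1 F by case: i => // v; rewrite -F_const.
pose k := [exists v, (f (v, false)).2].
have f_layer x : (f x).2 = x.2 (+) k.
  suff -> : k = (f x).2 (+) x.2 by rewrite addbC -addbA addbb addbF.
  have k_layer v : (f (v, false)).2 = (f x).2 (+) x.2.
    by rewrite -(layer_shift_const (v, false)) addbF.
  apply/existsP/idP => [[v] | fx]; first by rewrite k_layer.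
  by exists x.1; rewrite k_layer.
apply/imset2P; exists (perm (F_aut.1 false)) (perm (@addIb k)) => //.
  by apply/graph_autP=> v w; rewrite !permE -[RHS](F_aut.2 false) (F_const (~~ false)).
apply/permP=> -[v i]; rewrite permE /= !permE [LHS]surjective_pairing.
by congr pair; [apply: F_const | apply: f_layer].
Qed.

End LayerAction.

Lemma unstable_twofold_aut :
  connected_graph (double_cover e) -> unstable e ->
  exists2 F, twofold_aut F & exists v, F false v != F true v.
Proof.
move=> dc_conn unst.
have [f f_aut f_unexpected] :
    exists2 f, f \in graph_aut (double_cover e) & f \notin expected_aut e.
  by apply/subsetPn/negP=> sub; apply/unst/eqP; rewrite eqEsubset sub expected_aut_sub.
exists (layer_action f); first exact: layer_action_twofold_aut.
apply/existsP; apply: contraNT f_unexpected => /existsPn F_const.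
by apply: expected_aut_layer_action => // v; apply/eqP/negPn.
Qed.

Section TwofoldAut.
Variable F : bool -> T -> T.
Hypothesis F_aut : twofold_aut F.

Lemma twofold_aut_surj i y : exists x, F i x = y.
Proof. by exists (invF (F_aut.1 i) y); apply: f_invF. Qed.

Lemma card_common_nbhd_twofold_aut i v w :
  #|nbhd e (F i v) :&: nbhd e (F i w)| = #|nbhd e v :&: nbhd e w|.
Proof.
rewrite -(card_preimset _ (F_aut.1 (~~ i))); congr #|pred_of_set _|.
by apply/setP=> u; rewrite !inE !F_aut.2.
Qed.

Lemma complete_twofold_aut_eq v :
  irreflexive e -> (forall u w, u != w -> e u w) -> F false v = F true v.
Proof.
move=> e_irr e_complete; apply/eqP; apply: contraFT (e_irr v) => /e_complete.
by rewrite (F_aut.2 false).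
Qed.

Lemma twin_free_twofold_aut_eq v :
  symmetric e -> twin_free e ->
  twofold_aut (fun=> F true) -> F false v = F true v.
Proof.
move=> e_sym tf Ft_aut; apply: tf; apply/setP=> u; rewrite !inE.
have [w <-] := twofold_aut_surj true u.
by rewrite (F_aut.2 false) (Ft_aut.2 true).
Qed.

End TwofoldAut.

End DoubleCover.

Section Zp.
Variables (n : nat) (n_gt1 : (1 < n)%N).
Implicit Types x y : 'Z_n.

Lemma Zp_involution_half x : x *+ 2 = 0 -> x != 0 -> ~~ odd n /\ x = (n./2)%:R.
Proof.
move=> x2 x_neq0.
have x_lt : (x < n)%N by rewrite (leq_trans (ltn_ord x)) // Zp_cast.
have x_gt0 : (0 < x)%N by rewrite lt0n.
have /dvdnP [k Ek] : (n %| x.*2)%N.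
  by rewrite /dvdn -val_Zp_nat // -muln2 natrM natr_Zp mulr_natr x2.
have k_eq1 : k = 1%N.
  apply/eqP; rewrite eqn_leq -ltnS -(ltn_pmul2r (ltnW n_gt1)) -Ek mul2n ltn_double x_lt.
  by move: x_gt0; rewrite -double_gt0 Ek muln_gt0 => /andP [].
have x_double : x.*2 = n by rewrite Ek k_eq1 mul1n.
split; first by rewrite -x_double odd_double.
have -> : n./2 = x by rewrite -[in LHS]x_double doubleK.
by rewrite natr_Zp.
Qed.

Lemma Zp_involution_unique x y :
  x *+ 2 = 0 -> y *+ 2 = 0 -> x != 0 -> y != 0 -> x = y.
Proof.
by move=> x2 y2 /(Zp_involution_half x2) [_ ->] /(Zp_involution_half y2) [_ ->].
Qed.

Lemma odd_Zp_double_inj : odd n -> injective (fun x => x *+ 2).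
Proof.
move=> n_odd x y eq_xy; apply/eqP; rewrite -subr_eq0; apply: contraLR n_odd.
by move=> /Zp_involution_half [] //; rewrite mulrnBl eq_xy subrr.
Qed.

Lemma odd_Zp_add x y : ~~ odd n -> odd (x + y)%R = odd x (+) odd y.
Proof.
move=> n_even; rewrite -[x in LHS]natr_Zp -[y in LHS]natr_Zp -natrD val_Zp_nat //.
by rewrite odd_mod ?oddD //; apply: negbTE.
Qed.

Lemma odd_Zp_opp x : ~~ odd n -> odd (- x)%R = odd x.
Proof.
move=> n_even; have := odd_Zp_add x (- x) n_even.
by rewrite subrr /=; case: (odd x); case: odd.
Qed.

End Zp.

Section Cayley.
Variables (n : nat) (S : {set 'Z_n}).
Implicit Types x y s : 'Z_n.

Lemma cayley_sym : oppr_closed S -> symmetric (cayley S).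
Proof.
by move=> S_opp x y; apply/idP/idP=> /S_opp; rewrite opprB.
Qed.

Lemma cayley_ind (P : 'Z_n -> Prop) :
  connected_graph (cayley S) -> P 0 ->
  (forall x s, s \in S -> P x -> P (x + s)) -> forall x, P x.
Proof.
move=> conn P0 PS x; apply: connect_ind (conn 0 x) P0 => u v uv Pu.
by rewrite -(subrK u v) addrC; apply: PS.
Qed.

Lemma cayley_double_cover_ind (P : bool -> 'Z_n -> Prop) :
  connected_graph (double_cover (cayley S)) -> P false 0 ->
  (forall i x s, s \in S -> P i x -> P (~~ i) (x + s)) -> forall i x, P i x.
Proof.
move=> conn P0 PS i x.
apply: (connect_ind (P := fun u => P u.2 u.1)) (conn (0, false) (x, i)) P0.
move=> [u k] [v l] /andP [/= kl uv] Pu.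
have -> : l = ~~ k by case: k l kl {Pu} => [] [].
by rewrite -(subrK u v) addrC; apply: PS.
Qed.

Lemma nbhd_cayley x : nbhd (cayley S) x = [set x + s | s in S].
Proof.
by apply/setP=> y; rewrite inE -{2}(subrK x y) addrC (mem_imset _ _ (addrI x)).
Qed.

Lemma card_nbhd_cayley x : #|nbhd (cayley S) x| = #|S|.
Proof. by rewrite nbhd_cayley card_imset //; apply: addrI. Qed.

Lemma twin_free_cayley_shift k :
  twin_free (cayley S) -> (forall s, s \in S -> s - k \in S) -> k = 0.
Proof.
move=> tf S_sub_k; apply/esym/tf/eqP; rewrite eqEcard !card_nbhd_cayley leqnn andbT.
by apply/subsetP=> s; rewrite !inE /cayley subr0; apply: S_sub_k.
Qed.

Lemma cayley_mixed_parity (c : bool) :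
  (1 < n)%N -> ~~ odd n -> connected_graph (cayley S) -> ~ bipartite (cayley S) ->
  exists2 s, s \in S & odd s = c.
Proof.
move=> n_gt1 n_even conn nbip; have oddD x y := odd_Zp_add n_gt1 x y n_even.
case: c.
  apply/exists_inP; apply: contraT => /exists_inPn S_even.
  suff: ~~ odd (1%:R : 'Z_n) by rewrite val_Zp_nat // modn_small.
  apply: (cayley_ind (P := fun x => ~~ odd x)) => // x s /S_even s_even.
  by rewrite oddD => /negbTE ->.
have [u [v [uv odd_uv]]] := not_bipartite_edge (fun x : 'Z_n => odd x) nbip.
by exists (v - u) => //; rewrite oddD odd_Zp_opp // odd_uv addbb.
Qed.

Lemma unstable_cayley_twofold_aut :
  connected_graph (double_cover (cayley S)) -> unstable (cayley S) ->
  exists F, [/\ twofold_aut (cayley S) F, F false 0 = 0 & F true 0 != 0].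
Proof.
move=> dc_conn /(unstable_twofold_aut dc_conn) [F [F_inj F_edge] [v neq_v]].
exists (fun i x => F i (x + v) - F false v); split.
- split=> [i x y /addIr /F_inj /addIr // | i x y].
  have := F_edge i (x + v) (y + v); rewrite /cayley => edge_xy.
  by rewrite opprB addrA subrK edge_xy opprD addrACA subrr addr0.
- by rewrite add0r subrr.
- by rewrite add0r subr_eq0 eq_sym.
Qed.

End Cayley.

Section Doubling.
Variables (n : nat) (double_inj : injective (fun x : 'Z_n => x *+ 2)).
Implicit Types (S : {set 'Z_n}) (x y : 'Z_n).

Definition double_set (S : {set 'Z_n}) : {set 'Z_n} := [set s *+ 2 | s in S].

Lemma double_set_opp_closed S : oppr_closed S -> oppr_closed (double_set S).
Proof.
move=> S_opp _ /imsetP [s sS ->].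
by rewrite -mulNrn; apply/imset_f/S_opp.
Qed.

(* [w |-> x + y - w] permutes the common neighbours of [x] and [y], and fixes
   only the midpoint of [x] and [y]. *)
Lemma odd_card_common_nbhd_cayley S x y : oppr_closed S ->
  odd #|nbhd (cayley S) x :&: nbhd (cayley S) y| = (y - x \in double_set S).
Proof.
move=> S_opp.
rewrite (@odd_card_involution _ (fun w => x + y - w)); first last.
- move=> w; rewrite !inE /cayley => /andP [/S_opp xw /S_opp yw].
  have -> : x + y - w - x = - (w - y) by ring.
  have -> : x + y - w - y = - (w - x) by ring.
  by rewrite xw yw.
- by move=> w; ring.
set mid := [set w in _ | _].
have mid_double w : w \in mid -> y - x = (w - x) *+ 2.
  rewrite inE => /andP [_ /eqP w_mid].
  have -> : y = w + w - x by rewrite -{1}w_mid; ring.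
  by ring.
have [/imsetP [s sS yx] | yx] := boolP (y - x \in _).
  suff -> : mid = [set x + s] by rewrite cards1.
  apply/setP=> w; rewrite in_set1; apply/idP/eqP => [/mid_double | ->].
    by rewrite yx => /double_inj ->; rewrite addrC subrK.
  rewrite !inE /cayley; have -> : y = x + s *+ 2 by rewrite -yx addrC subrK.
  have -> : x + s - (x + s *+ 2) = - s by ring.
  have -> : x + s - x = s by ring.
  by rewrite sS S_opp //=; apply/eqP; ring.
suff -> : mid = set0 by rewrite cards0.
apply/setP=> w; rewrite in_set0; apply: contraNF yx => w_mid.
rewrite (mid_double _ w_mid); apply: imset_f.
by move: w_mid; rewrite !inE => /andP [/andP []].
Qed.

Lemma twofold_aut_double_set S F i :
  oppr_closed S -> twofold_aut (cayley S) F ->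
  twofold_aut (cayley (double_set S)) (fun=> F i).
Proof.
move=> S_opp F_aut; split=> [_ | _ v w]; first exact: F_aut.1.
rewrite /cayley -!odd_card_common_nbhd_cayley //.
by rewrite card_common_nbhd_twofold_aut.
Qed.

(* Doubling permutes the finitely many subsets of [Z_n], so that [S] is itself
   an iterated double. *)
Lemma twofold_aut_layer S F i :
  oppr_closed S -> twofold_aut (cayley S) F -> twofold_aut (cayley S) (fun=> F i).
Proof.
move=> S_opp F_aut.
have double_set_inj : injective double_set by apply: imset_inj.
have F_iter k : oppr_closed (iter k double_set S) /\
    twofold_aut (cayley (iter k.+1 double_set S)) (fun=> F i).
  elim: k => [|k [IH_opp IH_aut]]; first by split=> //; apply: twofold_aut_double_set.
  split; first exact: double_set_opp_closed.
  by apply: (twofold_aut_double_set i) IH_aut; apply: double_set_opp_closed.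
rewrite -(iter_order double_set_inj S) -orderSpred.
exact: (F_iter _).2.
Qed.

Lemma double_inj_twofold_aut_eq S F :
  oppr_closed S -> twin_free (cayley S) -> twofold_aut (cayley S) F ->
  F false =1 F true.
Proof.
move=> S_opp tf F_aut v; apply: (twin_free_twofold_aut_eq F_aut) => //.
  exact: cayley_sym.
exact: twofold_aut_layer.
Qed.

End Doubling.

Lemma unstable_cayley_even n (S : {set 'Z_n}) :
  (1 < n)%N -> oppr_closed S -> twin_free (cayley S) ->
  connected_graph (double_cover (cayley S)) -> unstable (cayley S) -> ~~ odd n.
Proof.
move=> n_gt1 S_opp tf dc_conn unst.
have [F F_aut [v]] := unstable_twofold_aut dc_conn unst.
apply: contraNN => /(odd_Zp_double_inj n_gt1) double_inj.
exact/eqP/(double_inj_twofold_aut_eq double_inj S_opp tf F_aut).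
Qed.

Section OppositePairs.
Variable V : finZmodType.
Implicit Types x y : V.

Definition opp_pair x : {set V} := [set x; - x].

Lemma in_opp_pair x y : (y \in opp_pair x) = (y == x) || (y == - x).
Proof. by rewrite !inE. Qed.

Lemma opp_pair_refl x : x \in opp_pair x.
Proof. by rewrite in_opp_pair eqxx. Qed.

Lemma opp_pairN x : opp_pair (- x) = opp_pair x.
Proof. by rewrite /opp_pair opprK setUC. Qed.

Lemma opp_pair_eq x y : y \in opp_pair x -> opp_pair y = opp_pair x.
Proof. by rewrite in_opp_pair => /orP [] /eqP ->; rewrite ?opp_pairN. Qed.

Lemma opp_pair_sym x y : (y \in opp_pair x) = (x \in opp_pair y).
Proof. by apply/idP/idP=> /opp_pair_eq ->; apply: opp_pair_refl. Qed.

Lemma opp_pair_opp_closed x : oppr_closed (opp_pair x).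
Proof.
by move=> y; rewrite !in_opp_pair eqr_opp eqr_oppLR orbC.
Qed.

Lemma card_setU_opp_pair (A : {set V}) x :
  oppr_closed A -> x \notin A -> #|A :|: opp_pair x| = (#|A| + (- x != x).+1)%N.
Proof.
move=> A_opp xA; rewrite eq_sym -cards2 (eqTleqif (leq_card_setU _ _)) //.
apply/pred0P=> y /=; apply: contraNF xA => /andP [yA].
by rewrite opp_pair_sym in_opp_pair => /orP [] /eqP ->; rewrite ?A_opp.
Qed.

Definition unique_involution (S : {set V}) : Prop :=
  {in S &, forall p q, - p = p -> - q = q -> p = q}.

Lemma two_opp_pairs_cover (S : {set V}) p q :
  unique_involution S -> oppr_closed S -> (#|S| <= 4)%N ->
  p \in S -> q \in S -> q \notin opp_pair p -> S = opp_pair p :|: opp_pair q.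
Proof.
move=> inv_uniq S_opp S_le4 pS qS pq.
have pair_sub s : s \in S -> opp_pair s \subset S.
  by move=> sS; apply/subsetP=> r;
    rewrite in_opp_pair => /orP [] /eqP ->; rewrite ?S_opp.
apply/eqP; rewrite eqEsubset subUset !pair_sub // !andbT.
apply/subsetP=> r rS; rewrite in_setU; apply: contraTT S_le4.
rewrite negb_or -ltnNge => /andP [rp rq].
have one_inv s t : s \in S -> t \in S -> t \notin opp_pair s ->
    (- s != s) || (- t != t).
  move=> sS tS; apply: contraNT.
  rewrite negb_or !negbK => /andP [/eqP s_inv /eqP t_inv].
  by rewrite (inv_uniq s t) ?opp_pair_refl.
have pq_opp : oppr_closed (opp_pair p :|: opp_pair q).
  by move=> s /setUP [] s_pq; apply/setUP; [left | right]; apply: opp_pair_opp_closed.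
have : (#|opp_pair p :|: opp_pair q :|: opp_pair r| <= #|S|)%N.
  by apply: subset_leq_card; rewrite subUset pair_sub // andbT subUset !pair_sub.
apply: leq_trans; rewrite card_setU_opp_pair //; last first.
  by apply/setUP=> -[]; apply/negP.
rewrite card_setU_opp_pair //; last exact: opp_pair_opp_closed.
rewrite cards2 eq_sym.
have := one_inv _ _ qS rS rq; have := one_inv _ _ pS rS rp.
have := one_inv _ _ pS qS pq.
by case: (- p != p); case: (- q != q); case: (- r != r).
Qed.

End OppositePairs.

(* Two neighbours [p], [q] of [0] that are not opposite span a unique 4-cycle
   through [0]. *)
Definition rhombic n (S : {set 'Z_n}) : Prop :=
  forall p q z, p \in S -> q \in S -> q \notin opp_pair p ->
  z - p \in S -> z - q \in S -> z = 0 \/ z = p + q.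

Section TwofoldCayley.
Variables (n : nat) (S : {set 'Z_n}) (F : bool -> 'Z_n -> 'Z_n).
Hypothesis S_opp : oppr_closed S.
Hypothesis F_aut : twofold_aut (cayley S) F.

Definition step (i : bool) (v s : 'Z_n) : 'Z_n := F (~~ i) (v + s) - F i v.

Definition straight : Prop :=
  forall i v s, s \in S -> step i v (- s) = - step i v s.

Lemma twofold_edge i v w : (F (~~ i) w - F i v \in S) = (w - v \in S).
Proof. exact: F_aut.2. Qed.

Lemma step_mem i v s : (step i v s \in S) = (s \in S).
Proof. by rewrite /step twofold_edge addrC addKr. Qed.

Lemma step_inj i v : injective (step i v).
Proof. by move=> s r /addIr /(F_aut.1 _) /addrI. Qed.

Lemma step_surj i v p : exists s, step i v s = p.
Proof. by exists (invF (@step_inj i v) p); apply: f_invF. Qed.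

Lemma step_back i v s : step (~~ i) (v + s) (- s) = - step i v s.
Proof. by rewrite /step negbK addrK opprB. Qed.

(* If [step i v] does not send [a] and [- a] to opposite elements, then the
   images of [v + a] and [v - a] have a second common neighbour. *)
Lemma step_opp_unique_midpoint i v a : a \in S ->
  (forall y, y - a \in S -> y + a \in S -> y = 0) ->
  step i v (- a) = - step i v a.
Proof.
move=> aS mid0; set p := step i v a; set q := step i v (- a).
have [y Fy] := twofold_aut_surj F_aut i (F i v + p + q).
have y_edge s : (y - v - s \in S) = (p + q - step i v s \in S).
  rewrite -addrA -opprD -[LHS](twofold_edge (~~ i)) negbK Fy.
  by congr (_ \in S); rewrite /step; ring.
have Ey : y = v.
  apply/eqP; rewrite -subr_eq0; apply/eqP/mid0.
    by rewrite y_edge addrAC subrr add0r step_mem S_opp.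
  by rewrite -[a in y - v + a]opprK y_edge addrK step_mem.
move: Fy; rewrite Ey -addrA -[LHS]addr0 => /addrI /esym /eqP.
by rewrite addrC addr_eq0 => /eqP.
Qed.

Lemma straight_rhombic_step i v s r : straight -> rhombic S ->
  s \in S -> r \in S -> step (~~ i) (v + s) r = step i v r.
Proof.
move=> str rho sS rS.
have [|r_neq] := boolP (r \in opp_pair s).
  rewrite in_opp_pair => /orP [] /eqP ->; last by rewrite step_back str.
  by apply: oppr_inj; rewrite -str // step_back.
set z := F i (v + s + r) - F i v.
have z_s : z - step i v s = step (~~ i) (v + s) r by rewrite /z /step negbK; ring.
have z_r : z - step i v r = step (~~ i) (v + r) s.
  by rewrite /z /step negbK (_ : v + r + s = v + s + r); ring.
have [||||| z0 | z_sum] := rho (step i v s) (step i v r) z.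
- by rewrite step_mem.
- by rewrite step_mem.
- by rewrite in_opp_pair -str // !(inj_eq (@step_inj i v)) -in_opp_pair.
- by rewrite z_s step_mem.
- by rewrite z_r step_mem.
- have sr0 : r + s = 0.
    by apply/(addrI v); rewrite addr0 [r + s]addrC addrA; apply/(F_aut.1 i)/subr0_eq.
  by case/negP: r_neq; rewrite in_opp_pair -[r == - s]addr_eq0 sr0 eqxx orbT.
- by rewrite -z_s z_sum addrAC subrr add0r.
Qed.

(* Since [step i v] maps the complement of [opp_pair s] onto a set closed under
   opposites, the image of [opp_pair s] is such a set as well. *)
Lemma step_opp_last_pair i v s : unique_involution S -> s \in S ->
  {in S, forall r, r \notin opp_pair s -> step i v (- r) = - step i v r} ->
  step i v (- s) = - step i v s.
Proof.
move=> inv_uniq sS str.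
have opp_image r : r \in S -> r \in opp_pair s ->
    - step i v r = step i v s \/ - step i v r = step i v (- s).
  move=> rS rs; have [t Et] := step_surj i v (- step i v r).
  suff: t \in opp_pair s.
    by rewrite -Et in_opp_pair => /orP [] /eqP ->; [left | right].
  apply: contraLR rs => ts; have tS : t \in S.
    by rewrite -(step_mem i v) Et S_opp ?step_mem.
  suff <- : - t = r by rewrite opp_pair_sym opp_pairN opp_pair_sym.
  by apply: (@step_inj i v); rewrite str // Et opprK.
have [s_inv | //] := opp_image s sS (opp_pair_refl s).
have NsS := S_opp sS.
have [Ns_opp | Ns_inv] := opp_image (- s) NsS (opp_pair_opp_closed (opp_pair_refl s)).
  by rewrite -Ns_opp opprK.
by rewrite s_inv; apply: inv_uniq; rewrite ?step_mem.
Qed.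

End TwofoldCayley.

Section Additive.
Variables (n : nat) (S : {set 'Z_n}) (F : bool -> 'Z_n -> 'Z_n).
Hypothesis F_aut : twofold_aut (cayley S) F.
Hypothesis F_false0 : F false 0 = 0.

(* [(x, i) |-> (F i x, i)] is an endomorphism of the group [Z_n x Z_2]. *)
Definition additive_layers : Prop :=
  forall i j x y, F (i (+) j) (x + y) = F i x + F j y.

Lemma straight_rhombic_additive :
  connected_graph (double_cover (cayley S)) -> straight S F -> rhombic S ->
  additive_layers.
Proof.
move=> conn str rho.
have step_const i x s : s \in S -> step F i x s = step F false 0 s.
  move=> sS; pose P i x := step F i x s = step F false 0 s.
  apply: (cayley_double_cover_ind (P := P)) conn _ _ i x => // i x r rS.
  rewrite /P => <-.
  exact: (straight_rhombic_step F_aut).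
have F_step i x s : s \in S -> F (~~ i) (x + s) = F i x + step F false 0 s.
  by move=> sS; rewrite -(step_const i x) // /step [RHS]addrC subrK.
move=> i j x y; pose P j y := F (i (+) j) (x + y) = F i x + F j y.
apply: (cayley_double_cover_ind (P := P)) conn _ _ j y => [|j y s sS]; rewrite /P.
  by rewrite addbF F_false0 !addr0.
by move=> IH; rewrite addbN addrA !F_step // IH [RHS]addrA.
Qed.

Lemma additive_wilson_C4 :
  (1 < n)%N -> additive_layers -> F true 0 != 0 -> wilson_C4 S.
Proof.
move=> n_gt1 F_add; set t := F true 0 => t_neq0.
have t2 : t *+ 2 = 0 by rewrite mulr2n -F_add addr0 F_false0.
have [n_even t_half] := Zp_involution_half n_gt1 t2 t_neq0.
have F_mul x : F false x = F false 1 * x.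
  rewrite -(natr_Zp x); elim: (nat_of_ord x) => [|k IH]; first by rewrite mulr0.
  by rewrite mulrSr (F_add false false) IH mulrDr mulr1.
split=> //; exists (F false 1).
  have [x Fx] := twofold_aut_surj F_aut false 1.
  by apply/unitrPr; exists x; rewrite -F_mul.
apply/eqP; rewrite -t_half eqEcard card_in_imset ?leqnn ?andbT; last first.
  by move=> s r _ _ /addrI; rewrite -!F_mul => /(F_aut.1 false).
apply/subsetP=> _ /imsetP [s sS ->].
rewrite -F_mul -F_add add0r -[F _ s]subr0 -[X in _ - X]F_false0.
by rewrite (twofold_edge F_aut false) subr0.
Qed.

End Additive.

Lemma eq_of_sub_eq (V : zmodType) (x y u v : V) : u = v -> x - y = u - v -> x = y.
Proof. by move=> ->; rewrite subrr => /subr0_eq. Qed.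

Ltac linear_from E :=
  first [apply: (eq_of_sub_eq E); ring | apply: (eq_of_sub_eq (esym E)); ring].

Lemma no0_unique_involution n (S : {set 'Z_n}) :
  (1 < n)%N -> 0 \notin S -> unique_involution S.
Proof.
move=> n_gt1 S_no0 p q pS qS p_inv q_inv.
have neq0 s : s \in S -> s != 0 by apply: contraTneq => ->.
apply: (Zp_involution_unique n_gt1); rewrite ?neq0 // mulr2n.
  by rewrite -{1}p_inv addNr.
by rewrite -{1}q_inv addNr.
Qed.

(* Either coincidence would make [p *+ 2] a common neighbour of [p] and [q]. *)
Definition generic n (S : {set 'Z_n}) : Prop :=
  forall p q, p \in S -> q \in S -> q \notin opp_pair p ->
  [/\ S = opp_pair p :|: opp_pair q, p *+ 2 != q *+ 2 & q != p *+ 3].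

Lemma order4_pair_complete n (S : {set 'Z_n}) p q :
  connected_graph (cayley S) -> S = opp_pair p :|: opp_pair q ->
  p *+ 4 = 0 -> q = p *+ 2 -> forall x y, x != y -> cayley S x y.
Proof.
move=> conn S_pairs p4 Eq.
have mul_p x : exists k, x = p *+ k.
  pose P x := exists k, x = p *+ k.
  apply: (cayley_ind (P := P)) conn _ _ x => [|_ s + [k ->]]; first by exists 0%N.
  rewrite S_pairs !inE -!orbA => /or4P [] /eqP ->.
  - by exists (k + 1)%N; rewrite mulrnDr.
  - by exists (k + 3)%N; rewrite mulrnDr; linear_from p4.
  - by exists (k + 2)%N; rewrite mulrnDr Eq.
  - by exists (k + 2)%N; rewrite mulrnDr Eq; linear_from p4.
move=> x y; rewrite eq_sym -subr_eq0 /cayley; have [k ->] := mul_p (y - x).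
rewrite (divn_eq k 4) mulnC mulrnDr mulrnA p4 mul0rn add0r.
have := ltn_pmod k (isT : 0 < 4)%N; case: (k %% 4)%N => [|[|[|[|//]]]] _.
- by rewrite eqxx.
- by rewrite S_pairs !inE eqxx.
- by rewrite S_pairs !inE Eq eqxx !orbT.
- suff -> : p *+ 3 = - p by rewrite S_pairs !inE eqxx orbT.
  by linear_from p4.
Qed.

Section Generic.
Variables (n : nat) (S : {set 'Z_n}).
Hypothesis S_gen : generic S.

Lemma generic_neq_triple p q :
  p \in S -> q \in S -> q \notin opp_pair p -> p != q *+ 3.
Proof. by move=> pS qS; rewrite opp_pair_sym => /(S_gen qS pS) []. Qed.

Lemma generic_rhombic : rhombic S.
Proof.
move=> p q z pS qS pq; have [-> /eqP pq2 /eqP q3p] := S_gen pS qS pq.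
have /eqP p3q := generic_neq_triple pS qS pq.
rewrite !inE -!orbA => /or4P z_p /or4P z_q.
have {z_p} : [\/ z = p *+ 2, z = 0, z = p + q | z = p - q].
  by case: z_p => /eqP Ez;
    [constructor 1 | constructor 2 | constructor 3 | constructor 4]; linear_from Ez.
have {z_q} : [\/ z = p + q, z = q - p, z = q *+ 2 | z = 0].
  by case: z_q => /eqP Ez;
    [constructor 1 | constructor 2 | constructor 3 | constructor 4]; linear_from Ez.
case=> Ez; case=> Ez'; rewrite {}Ez in Ez' *; try by [left | right].
- by case: q3p; linear_from Ez'.
- by case: pq2; linear_from Ez'.
- by case: pq2; linear_from Ez'.
- by case: p3q; linear_from Ez'.
Qed.

Lemma generic_unique_midpoint a y :
  a \in S -> a *+ 4 != 0 -> y - a \in S -> y + a \in S -> y = 0.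
Proof.
move=> aS a4; set p := y + a; set r := y - a => rS pS.
have pr : p - r = a *+ 2 by rewrite /p /r; ring.
have a2 : a *+ 2 != 0 by apply: contraNneq a4 => a2; rewrite (mulrnA a 2 2) a2 mul0rn.
have [ | p_r] := boolP (p \in opp_pair r).
  rewrite in_opp_pair => /orP [] /eqP Ep; first by rewrite -pr Ep subrr eqxx in a2.
  have pa2 : a *+ 2 = p *+ 2 by rewrite -pr -[r]opprK -Ep opprK mulr2n.
  have [ | p_a] := boolP (p \in opp_pair a); last first.
    by have [_] := S_gen aS pS p_a; rewrite pa2 eqxx.
  rewrite in_opp_pair => /orP [] /eqP Epa; first by rewrite -[y](addrK a) -/p Epa subrr.
  by case/eqP: a4; rewrite Epa in pa2; linear_from pa2.
have [S_pairs _ /eqP p3r] := S_gen rS pS p_r.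
have /eqP r3p := generic_neq_triple rS pS p_r.
have /eqP pNr : p != - r by apply: contraNneq p_r => ->; rewrite in_opp_pair eqxx orbT.
move: aS; rewrite S_pairs !inE -!orbA => /or4P [] /eqP Ea; rewrite Ea in pr.
- by case: p3r; linear_from pr.
- by case: pNr; linear_from pr.
- by case: pNr; linear_from pr.
- by case: r3p; linear_from pr.
Qed.

Lemma generic_order4_complete p q :
  (1 < n)%N -> 0 \notin S -> connected_graph (cayley S) ->
  p \in S -> q \in S -> q \notin opp_pair p -> p *+ 4 = 0 -> q *+ 4 = 0 ->
  forall x y, x != y -> cayley S x y.
Proof.
move=> n_gt1 S_no0 conn pS qS pq p4 q4.
have neq0 s : s \in S -> s != 0 by apply: contraTneq => ->.
have [S_pairs p2q2 _] := S_gen pS qS pq.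
have [p2 | p2] := eqVneq (p *+ 2) 0.
  rewrite p2 eq_sym in p2q2; rewrite setUC in S_pairs.
  apply: (order4_pair_complete conn S_pairs q4).
  by apply: (Zp_involution_unique n_gt1); rewrite -?mulrnA ?(neq0 p).
apply: (order4_pair_complete conn S_pairs p4).
have q2 : q *+ 2 = 0.
  apply: contraNeq p2q2 => q2; apply/eqP.
  by apply: (Zp_involution_unique n_gt1); rewrite -?mulrnA.
by apply: (Zp_involution_unique n_gt1); rewrite -?mulrnA ?(neq0 q).
Qed.

Lemma generic_straight_off_pair F b :
  oppr_closed S -> unique_involution S -> twofold_aut (cayley S) F ->
  {in S, forall s, s \notin opp_pair b -> s *+ 4 != 0} -> straight S F.
Proof.
move=> S_opp inv_uniq F_aut order4 i v s sS.
have str r : r \in S -> r \notin opp_pair b -> step F i v (- r) = - step F i v r.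
  move=> rS rb; apply: (step_opp_unique_midpoint S_opp F_aut) => // y.
  by apply: generic_unique_midpoint (order4 r rS rb).
have [sb | /str] := boolP (s \in opp_pair b); last exact.
apply: (step_opp_last_pair S_opp F_aut) => // r rS.
by rewrite (opp_pair_eq sb); apply: str.
Qed.

Lemma generic_straight F :
  (1 < n)%N -> 0 \notin S -> oppr_closed S -> connected_graph (cayley S) ->
  twofold_aut (cayley S) F -> F false 0 != F true 0 -> straight S F.
Proof.
move=> n_gt1 S_no0 S_opp conn F_aut F_neq.
have inv_uniq := no0_unique_involution n_gt1 S_no0.
have [b /andP [bS /eqP b4] | no_order4] := pickP [pred b in S | b *+ 4 == 0];
  last first.
  apply: (generic_straight_off_pair (b := 0)) => // s sS _.
  by have := no_order4 s; rewrite /= sS /= => ->.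
apply: (generic_straight_off_pair (b := b)) => // s sS sb.
apply: contraNneq F_neq => s4; apply/eqP/(complete_twofold_aut_eq F_aut).
  by move=> x; rewrite /cayley subrr; apply: negbTE.
exact: (generic_order4_complete n_gt1 S_no0 conn bS sS sb b4 s4).
Qed.

End Generic.

Lemma card_le4_generic n (S : {set 'Z_n}) :
  (1 < n)%N -> ~~ odd n -> 0 \notin S -> oppr_closed S -> (#|S| <= 4)%N ->
  connected_graph (cayley S) -> ~ bipartite (cayley S) -> twin_free (cayley S) ->
  generic S.
Proof.
move=> n_gt1 n_even S_no0 S_opp S_le4 conn nbip tf p q pS qS pq.
have inv_uniq := no0_unique_involution n_gt1 S_no0.
have S_pairs := two_opp_pairs_cover inv_uniq S_opp S_le4 pS qS pq.
have S_le s : s \in S -> [\/ s = p, s = - p, s = q | s = - q].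
  rewrite S_pairs !inE -!orbA => /or4P [] /eqP ->;
  by [constructor 1 | constructor 2 | constructor 3 | constructor 4].
split=> //.
  apply: contraNneq pq => pq2; suff -> : q = p by apply: opp_pair_refl.
  apply/esym/subr0_eq/(twin_free_cayley_shift tf) => s /S_le Es.
  suff : [\/ s - (p - q) = p, s - (p - q) = - p, s - (p - q) = q | s - (p - q) = - q].
    by case=> ->; rewrite ?S_opp.
  case: Es => ->; [constructor 3 | constructor 4 | constructor 1 | constructor 2];
    solve [ring | linear_from pq2].
apply/eqP=> q3; have odd_S s : s \in S -> odd s = odd p.
  have odd_q : odd q = odd p.
    by rewrite q3 !mulrSr mulr0n !odd_Zp_add //=; case: (odd p).
  by move/S_le=> [] ->; rewrite ?odd_Zp_opp ?odd_q.
have [s /odd_S -> /eqP] := cayley_mixed_parity (~~ odd p) n_gt1 n_even conn nbip.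
by case: (odd p).
Qed.

Theorem theorem4p1 (n : nat) (n_gt1 : (1 < n)%N) (S : {set 'Z_n})
    (S_no0 : 0 \notin S) (S_sym : [set - s | s in S] = S)
    (d : nat) (d_val : has_valency (cayley S) d) (d_le4 : (d <= 4)%N)
    (S_unst : nontrivially_unstable (cayley S)) :
  wilson_C4 S.
Proof.
have [conn nbip tf unst] := S_unst.
have S_opp : oppr_closed S by move=> s sS; rewrite -S_sym imset_f.
have S_le4 : (#|S| <= 4)%N by rewrite -(card_nbhd_cayley S 0) d_val.
have dc_conn := double_cover_connected (cayley_sym S_opp) conn nbip.
have n_even := unstable_cayley_even n_gt1 S_opp tf dc_conn unst.
have S_gen := card_le4_generic n_gt1 n_even S_no0 S_opp S_le4 conn nbip tf.
have [F [F_aut F_false0 F_true0]] := unstable_cayley_twofold_aut dc_conn unst.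
have F_straight : straight S F.
  by apply: generic_straight => //; rewrite F_false0 eq_sym.
have F_add : additive_layers F.
  exact: straight_rhombic_additive dc_conn F_straight (generic_rhombic S_gen).
exact: additive_wilson_C4 F_aut F_false0 n_gt1 F_add F_true0.
Qed.
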